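(* Let $A$ be any implementable allocation rule. Let $\pi_i : \mathcal V_i \to [0,\infty)$, $i = 1,\dots,n$, be measurable functions, and let $P^*$ be the payment rule in which a bidder $i$ with the largest value of $\pi_i(v_i)$ (ties broken by an arbitrary fixed rule) pays $\pi_i(v_i)$ and all other bidders pay $0$. If $P^*$ satisfies revenue equivalence, i.e. $\mathbb E[P_i^*(\bm v) \mid v_i] = z_i(v_i)$ for all $i, v_i$, then for every convex $g : \mathbb R \to \mathbb R$ and every (non-negative) payment rule $P$ implementing $A$, $\mathbb E[g(\sum_i P_i^*(\bm v))] \le \mathbb E[g(\sum_i P_i(\bm v))]$ (whenever these expectations exist).
   Context: Setting: $n$ risk-neutral unit-demand bidders and $k$ identical items, $1 \le k < n$. Bidder $i$ has private value $v_i \in \mathcal V_i = [0,\bar v_i]$, drawn independently across bidders from a distribution $F_i$ with density $f_i > 0$ on $\mathcal V_i$ (distributions may differ across bidders); $\bm v = (v_1,\dots,v_n)$, $\mathcal V = \prod_i \mathcal V_i$. An allocation rule is a measurable map $A : \mathcal V \to \{0,1\}^n$ with $\sum_i A_i(\bm v) \le k$. Its interim allocation is $x_i(v_i) = \mathbb E[A_i(\bm v) \mid v_i]$, and $A$ is called implementable if every $x_i$ is non-decreasing. Its interim payment function is $z_i(v_i) = v_i x_i(v_i) - \int_0^{v_i} x_i(u)\,du$. A payment rule is a measurable map $P : \mathcal V \to [0,\infty)^n$ (payments are non-negative). $P$ implements $A$ if $(A,P)$ is Bayesian incentive compatible, i.e. $\mathbb E[v_i A_i(\bm v) - P_i(\bm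 v) \mid v_i] \ge \mathbb E[v_i A_i(v_i',\bm v_{-i}) - P_i(v_i',\bm v_{-i}) \mid v_i]$ for all $i, v_i, v_i'$, and satisfies revenue equivalence $\mathbb E[P_i(\bm v) \mid v_i] = z_i(v_i)$ for all $i, v_i$. *)

(* Defs.v *)
From HB Require Import structures.
From mathcomp Require Import all_boot all_order all_algebra.
From mathcomp Require Import all_classical all_reals all_analysis.
Set Implicit Arguments. Unset Strict Implicit. Unset Printing Implicit Defensive.
Import Order.TTheory GRing.Theory Num.Theory.
Import numFieldNormedType.Exports.
Local Open Scope classical_set_scope.
Local Open Scope ring_scope.

(* A value profile v = (v_1,...,v_n) is an n-tuple of reals; n.-tuple R carries
   the product sigma-algebra (generated by the coordinate projections). *)

Definition itv0 {R : realType} (b : R) : set R := `[0, b]%classic.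

Section Auction.
Context {R : realType} {n : nat}.

Definition upd (v : n.-tuple R) (i : 'I_n) (x : R) : n.-tuple R :=
  [tuple (if j == i then x else tnth v j) | j < n].

Definition indep_coords (mu : probability (n.-tuple R) R) : Prop :=
  forall B : 'I_n -> set R, (forall i, measurable (B i)) ->
    mu [set v | forall i, B i (tnth v i)] =
    (\prod_(i < n) mu [set v | B i (tnth v i)])%E.

Definition marginal_density (mu : probability (n.-tuple R) R)
  (vbar : 'I_n -> R) (f : 'I_n -> R -> R) : Prop :=
  forall i, [/\ 0 < vbar i, measurable_fun setT (f i),
    (forall x, x \in `[0, vbar i] -> 0 < f i x) &
    forall B, measurable B ->
      mu [set v | B (tnth v i)] =
      (\int[lebesgue_measure]_(x in B `&` itv0 (vbar i)) (f i x)%:E)%E].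

Definition alloc_rule (k : nat) (A : n.-tuple R -> 'I_n -> bool) : Prop :=
  (forall i, measurable [set v | A v i]) /\
  (forall v, (\sum_(i < n) (A v i : nat) <= k)%N).

Definition payment_rule (P : n.-tuple R -> 'I_n -> R) : Prop :=
  forall i, measurable_fun setT (fun v => P v i) /\ forall v, 0 <= P v i.

(* interim allocation x_i(v_i) = E[A_i(v) | v_i] = E_{v_{-i}}[A_i(v_i, v_{-i})]
   (independence of the coordinates). *)
Definition interim_alloc (mu : probability (n.-tuple R) R)
  (A : n.-tuple R -> 'I_n -> bool) (i : 'I_n) (x : R) : R :=
  Rintegral mu setT (fun v => (A (upd v i x) i)%:R).

Definition implementable (mu : probability (n.-tuple R) R) (vbar : 'I_n -> R)
  (A : n.-tuple R -> 'I_n -> bool) : Prop :=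
  forall i, {in `[0, vbar i] &, {homo interim_alloc mu A i : x y / x <= y}}.

Definition interim_pay (mu : probability (n.-tuple R) R)
  (A : n.-tuple R -> 'I_n -> bool) (i : 'I_n) (x : R) : R :=
  x * interim_alloc mu A i x -
  Rintegral lebesgue_measure (itv0 x) (interim_alloc mu A i).

Definition revenue_equivalence (mu : probability (n.-tuple R) R)
  (vbar : 'I_n -> R) (A : n.-tuple R -> 'I_n -> bool)
  (P : n.-tuple R -> 'I_n -> R) : Prop :=
  forall i x, x \in `[0, vbar i] ->
    (\int[mu]_v (P (upd v i x) i)%:E)%E = (interim_pay mu A i x)%:E.

Definition BIC (mu : probability (n.-tuple R) R) (vbar : 'I_n -> R)
  (A : n.-tuple R -> 'I_n -> bool) (P : n.-tuple R -> 'I_n -> R) : Prop :=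
  forall i x x', x \in `[0, vbar i] -> x' \in `[0, vbar i] ->
    (\int[mu]_v (x * (A (upd v i x') i)%:R - P (upd v i x') i)%:E <=
     \int[mu]_v (x * (A (upd v i x) i)%:R - P (upd v i x) i)%:E)%E.

Definition implements (mu : probability (n.-tuple R) R) (vbar : 'I_n -> R)
  (A : n.-tuple R -> 'I_n -> bool) (P : n.-tuple R -> 'I_n -> R) : Prop :=
  [/\ payment_rule P, BIC mu vbar A P & revenue_equivalence mu vbar A P].

(* the payment rule P^*: the winner w(v) (a bidder maximising pi_i(v_i), ties
   broken by the fixed rule w) pays pi_{w(v)}(v_{w(v)}); all others pay 0 *)
Definition Pstar (pi : 'I_n -> R -> R) (w : n.-tuple R -> 'I_n)
  (v : n.-tuple R) (i : 'I_n) : R :=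
  if i == w v then pi i (tnth v i) else 0.

Definition expectation_exists (mu : probability (n.-tuple R) R)
  (h : n.-tuple R -> R) : Prop :=
  (\int[mu]_v (Num.max (h v) 0)%:E < +oo)%E \/
  (\int[mu]_v (Num.max (- h v) 0)%:E < +oo)%E.

End Auction.

(* Main.v *)
Require Import Defs.
From HB Require Import structures.
From mathcomp Require Import all_boot all_order all_algebra.
From mathcomp Require Import all_classical all_reals all_analysis.
From mathcomp Require Import measurable_realfun ring lra.
Import Order.TTheory GRing.Theory Num.Theory.
Import numFieldNormedType.Exports.
Local Open Scope classical_set_scope.
Local Open Scope ring_scope.

(* Let M and S be the total payments under P^* and P; M is the maximum of the
   pi_i(v_i), and E[M] = E[S] by revenue equivalence. By the subgradient
   inequality for g it then suffices that
   E[psi(M) M] <= E[psi(M) S] for every nondecreasing psi >= 0. A bidder pays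
   under P^* only when pi_i(v_i) = M, so by independence and revenue equivalence
   E[psi(M) P^*_i] = E[psi(pi_i(v_i)) P^*_i] = E[psi(pi_i(v_i)) P_i]
                  <= E[psi(M) P_i],
   the last step because P_i >= 0 and pi_i(v_i) <= M. *)

(** * Independence of the coordinates as invariance under redrawing one of them *)

Section Resampling.
Context {R : realType} {n : nat}.
Implicit Types (mu : probability (n.-tuple R) R) (i : 'I_n).

Lemma tnth_upd (v : n.-tuple R) i x j :
  tnth (upd v i x) j = if j == i then x else tnth v j.
Proof. by rewrite tnth_mktuple. Qed.

Lemma upd_tnth (v : n.-tuple R) i : upd v i (tnth v i) = v.
Proof. by apply: eq_from_tnth => j; rewrite tnth_upd; case: eqP => [->|]. Qed.

Definition box (B : 'I_n -> set R) : set (n.-tuple R) :=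
  [set v | forall i, B i (tnth v i)].

Lemma measurable_box B : (forall i, measurable (B i)) -> measurable (box B).
Proof.
move=> mB; rewrite (_ : box B = \bigcap_(i in [set: 'I_n]) (@tnth n R ^~ i @^-1` B i)).
  apply: fin_bigcap_measurable => // i _; rewrite -[X in measurable X]setTI.
  by apply: measurable_tnth.
by apply/seteqP; split => [v vB i _|v vB i]; [exact: vB|exact: vB i I].
Qed.

Let boxes : set (set (n.-tuple R)) :=
  [set box B | B in [set B | forall i, measurable (B i)]].

Let measurable_boxes : @measurable _ (n.-tuple R) = <<s boxes >>.
Proof.
apply/seteqP; split; last first.
  apply: smallest_sub; first exact: sigma_algebra_measurable.
  by move=> _ [B mB <-]; exact: measurable_box.
apply: smallest_sub; first exact: smallest_sigma_algebra.
move=> A; rewrite -bigcup_seq => -[i _ [C mC <-]]; apply: sub_sigma_algebra.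
(* A cylinder over coordinate [i] is a box whose other sides are the whole line. *)
exists (fun j => if j == i then C else setT).
  by move=> j /=; case: ifP.
apply/seteqP; split=> [v /(_ i)|v [_ Cv] j]; first by rewrite eqxx.
by case: eqP => // ->.
Qed.

(** Boxes are stable under intersection and generate the product sigma-algebra. This carries
    [indep_coords], a statement about boxes only, to all events. *)
Lemma measure_box_unique (m1 m2 : {measure set (n.-tuple R) -> \bar R}) :
  (m1 setT < +oo)%E ->
  (forall B, (forall i, measurable (B i)) -> m1 (box B) = m2 (box B)) ->
  forall A, measurable A -> m1 A = m2 A.
Proof.
move=> m1T m12; apply: (measure_unique boxes (fun=> setT)) => //.
- move=> _ _ [B mB <-] [C mC <-].
  exists (fun i => B i `&` C i) => [i|]; first exact: measurableI.
  apply/seteqP; split => [v vBC|v [vB vC] i //].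
  by split => i; case: (vBC i).
- by move=> _; exists (fun=> setT) => //; apply/seteqP; split.
- by apply/seteqP; split => // v _; exists 0%N.
- by move=> _ [B mB <-]; exact: m12.
Qed.

Let resample i (vv : n.-tuple R * n.-tuple R) := upd vv.2 i (tnth vv.1 i).

Let measurable_resample i : measurable_fun setT (resample i).
Proof.
apply/measurable_fun_tnthP => j.
rewrite (_ : _ \o _ = if j == i then (@tnth n R ^~ i) \o fst
                      else (@tnth n R ^~ j) \o snd); last first.
  by apply/funext => vv /=; rewrite tnth_upd; case: ifP.
by case: ifP => _; apply: measurableT_comp => //; exact: measurable_tnth.
Qed.

(** The preimage of a box under [resample i] is a rectangle: side [i] constrains the first profile
    only, the other sides the second one only. Its product mass factors exactly as [indep_coords]
    factors the mass of the box. *)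
Lemma indep_coords_resample mu i : indep_coords mu ->
  forall A, measurable A ->
  pushforward (mu \x mu)%E (resample i) A = mu A.
Proof.
have prodE A1 A2 : measurable A1 -> measurable A2 ->
    (mu \x mu)%E (A1 `*` A2) = (mu A1 * mu A2)%E by exact: product_measure1E.
have muT : mu [set: n.-tuple R] = 1%E by exact: probability_setT.
move=> indep; apply: (@measure_box_unique (pushforward (mu \x mu)%E (resample i))).
  rewrite /= /pushforward preimage_setT -setXTT prodE//. by rewrite muT mule1 ltry.
move=> B mB; pose B' j := if j == i then setT else B j.
have mB' j : measurable (B' j) by rewrite /B'; case: ifP.
rewrite /= /pushforward (_ : _ @^-1` _ = (@tnth n R ^~ i @^-1` B i) `*` box B').
  rewrite prodE//; last exact: measurable_box.
    rewrite /box !indep// (bigD1 i)//= [in RHS](bigD1 i)//=; congr (_ * _)%E.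
    rewrite /B' eqxx (_ : [set _ | _] = setT) ?muT ?mul1e; last first.
      by apply/seteqP; split.
    by apply: eq_bigr => j /negbTE ->.
  by rewrite -[X in measurable X]setTI; apply: measurable_tnth.
apply/seteqP; split=> [[v v'] /= vB|[v v'] /= [vB v'B] j].
  split; first by have := vB i; rewrite tnth_upd eqxx.
  by move=> j; have := vB j; rewrite /B' tnth_upd; case: eqP.
by have := v'B j; rewrite /B' tnth_upd; case: eqP => // ->.
Qed.

(** The tower property: conditioning on [v_i] amounts to integrating over a fresh profile [v'] whose
    coordinate [i] is pinned to [tnth v i]. It is Tonelli after the change of variables
    [resample i]. *)
Lemma indep_coords_integral mu i (h : n.-tuple R -> \bar R) : indep_coords mu ->
  measurable_fun setT h -> (forall v, 0 <= h v)%E ->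
  (\int[mu]_v h v = \int[mu]_v \int[mu]_v' h (upd v' i (tnth v i)))%E.
Proof.
move=> indep mh h0.
transitivity (\int[pushforward (mu \x mu)%E (resample i)]_v h v)%E.
  apply: eq_measure_integral => A mA _; apply/esym.
  exact: indep_coords_resample indep _ mA.
rewrite ge0_integral_pushforward// preimage_setT fubini_tonelli1//.
  exact: measurableT_comp.
by move=> vv; exact: h0.
Qed.

Lemma measurable_upd i x : measurable_fun setT (fun v : n.-tuple R => upd v i x).
Proof.
apply/measurable_fun_tnthP => j.
rewrite (_ : _ \o _ = if j == i then cst x else (@tnth n R ^~ j)); last first.
  by apply/funext => v /=; rewrite tnth_upd; case: ifP.
by case: ifP => _ //; exact: measurable_tnth.
Qed.

(** Given [v_i] the weight [psi] is constant and leaves the inner integral, so an interim inequality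
    survives any non-negative weight in [v_i] alone. The set [D] of full mass appears because
    revenue equivalence speaks only of types in [[0, vbar i]]. *)
Lemma indep_coords_interim_le mu i (D : set R) (psi : R -> R)
    (h1 h2 : n.-tuple R -> R) : indep_coords mu ->
  measurable D -> mu [set v | ~ D (tnth v i)] = 0 ->
  measurable_fun setT psi -> (forall x, 0 <= psi x) ->
  measurable_fun setT h1 -> (forall v, 0 <= h1 v) ->
  measurable_fun setT h2 -> (forall v, 0 <= h2 v) ->
  (forall x, D x ->
    \int[mu]_v (h1 (upd v i x))%:E <= \int[mu]_v (h2 (upd v i x))%:E)%E ->
  (\int[mu]_v (psi (tnth v i) * h1 v)%:E <=
   \int[mu]_v (psi (tnth v i) * h2 v)%:E)%E.
Proof.
move=> indep mD D0 mpsi psi0 mh1 h10 mh2 h20 h12.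
have mpsii : measurable_fun setT (fun v : n.-tuple R => psi (tnth v i)).
  by apply: measurableT_comp => //; exact: measurable_tnth.
have interimE (h : n.-tuple R -> R) :
    measurable_fun setT h -> (forall v, 0 <= h v) ->
    (\int[mu]_v (psi (tnth v i) * h v)%:E =
    \int[mu]_v ((psi (tnth v i))%:E * \int[mu]_v' (h (upd v' i (tnth v i)))%:E))%E.
  move=> mh h0; rewrite (@indep_coords_integral _ i)//; last 2 first.
  - by apply/measurable_EFinP/measurable_funM.
  - by move=> v; rewrite lee_fin mulr_ge0.
  apply: eq_integral => v _.
  under eq_integral do rewrite tnth_upd eqxx EFinM.
  rewrite ge0_integralZl_EFin//; first by move=> v' _; rewrite lee_fin.
  apply/measurable_EFinP; apply: measurableT_comp => //; exact: measurable_upd.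
rewrite !interimE//.
have minterim (h : n.-tuple R -> R) :
    measurable_fun setT h -> (forall v, 0 <= h v) ->
    measurable_fun setT (fun v => (psi (tnth v i))%:E *
      \int[mu]_v' (h (upd v' i (tnth v i)))%:E)%E.
  move=> mh h0; apply: emeasurable_funM; first exact/measurable_EFinP.
  (* The inner integral is a section integral of [h \o resample i], hence measurable by Tonelli. *)
  apply: (@measurable_fun_fubini_tonelli_F _ _ _ _ _ mu (fun vv => (h (resample i vv))%:E)).
    by apply/measurable_EFinP; apply: measurableT_comp.
  by move=> vv; rewrite lee_fin.
have interim0 (h : n.-tuple R -> R) v : (forall v, 0 <= h v) ->
    (0 <= (psi (tnth v i))%:E * \int[mu]_v' (h (upd v' i (tnth v i)))%:E)%E.
  by move=> h0; rewrite mule_ge0 ?lee_fin// integral_ge0// => v' _; rewrite lee_fin.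
apply: ae_ge0_le_integral => //; [|exact: minterim| |exact: minterim|].
- by move=> v _; exact: interim0.
- by move=> v _; exact: interim0.
exists [set v | ~ D (tnth v i)]; split => //.
  rewrite -[X in measurable X]setTI.
  by apply: (@measurable_tnth _ _ n i measurableT (~` D)); exact: measurableC.
move=> v /= /not_implyP[_ nle] Dv; apply: nle.
by apply: lee_wpmul2l; [rewrite lee_fin|exact: h12].
Qed.
End Resampling.

(** * Convex functions on the line: subgradients and measurability *)

(** Convexity at three points with denominators cleared, so that slope comparisons become polynomial
    and the degenerate case [y = z] is included. *)
Lemma convex_function_chord (R : realType) (g : R -> R) :
  @convex_function R R^o [set: R^o] g ->
  forall y x z, y <= x -> x <= z ->
    g x * (z - y) <= g y * (z - x) + g z * (x - y).
Proof.
move=> cg y x z yx xz.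
have [->|zy] := eqVneq z y; first lra.
have zy0 : 0 < z - y by lra.
have t0 : 0 <= (z - x) / (z - y) by rewrite divr_ge0; lra.
have t1 : (z - x) / (z - y) <= 1 by rewrite ler_pdivrMr; lra.
(* [x] is the convex combination of [y] and [z] with weight [(z - x) / (z - y)] on [y]. *)
have := cg (Itv01 t0 t1) y z (in_setT _) (in_setT _).
rewrite !convRE /= /unstable.onem.
rewrite [X in g X]convRE /= /unstable.onem.
have -> : (z - x) / (z - y) * y + (1 - (z - x) / (z - y)) * z = x by field; lra.
rewrite -(ler_pM2r zy0) => /le_trans; apply.
by rewrite le_eqVlt; apply/orP; left; apply/eqP; field; lra.
Qed.

(** The subgradient chosen is the right derivative, taken as the infimum of the slopes of the chords
    from [x] to points on its right. *)
Lemma convex_function_subgradient (R : realType) (g : R -> R) :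
  @convex_function R R^o [set: R^o] g ->
  exists2 s : R -> R, {homo s : x y / x <= y} &
    forall x y, g x + s x * (y - x) <= g y.
Proof.
move=> /convex_function_chord cg.
pose slopes x := [set (g y - g x) / (y - x) | y in [set y | x < y]].
have slopes0 x : slopes x !=set0.
  by exists ((g (x + 1) - g x) / (x + 1 - x)), (x + 1) => //=; lra.
(* Slopes on the left of [x] bound those on the right from below. This makes the infimum a genuine
   one and also gives the subgradient inequality at points on the left. *)
have slopes_lb x y : y < x -> lbound (slopes x) ((g x - g y) / (x - y)).
  move=> yx _ [z /= xz <-].
  rewrite ler_pdivrMr; last lra.
  rewrite mulrAC ler_pdivlMr; last lra.
  by have := cg y x z (ltW yx) (ltW xz); nra.
have sub x y : g x + inf (slopes x) * (y - x) <= g y.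
  have [yx|xy|->] := ltgtP y x; last by rewrite subrr mulr0 addr0.
  - have : (g x - g y) / (x - y) <= inf (slopes x).
      by apply: lb_le_inf => //; exact: slopes_lb.
    by rewrite ler_pdivrMr; nra.
  - have : inf (slopes x) <= (g y - g x) / (y - x).
      apply: ge_inf; last by exists y.
      by exists ((g x - g (x - 1)) / (x - (x - 1))); apply: slopes_lb; lra.
    by rewrite ler_pdivlMr; lra.
exists (inf \o slopes) => //= x y; rewrite le_eqVlt => /predU1P[->//|xy].
(* Adding the two subgradient inequalities gives [(s y - s x) * (y - x) >= 0]. *)
by have := sub x y; have := sub y x; nra.
Qed.

(** Once the supporting line at 0 is removed, [G] is non-increasing on the negative half-line and
    non-decreasing on the positive one. So [g] is a difference of two monotone functions plus an
    affine one. *)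
Lemma subgradient_measurable (R : realType) (g s : R -> R) :
  (forall x y, g x + s x * (y - x) <= g y) -> {homo s : x y / x <= y} ->
  measurable_fun setT g.
Proof.
move=> sub s_nd; pose G x := g x - g 0 - s 0 * x.
have GE x : G x = G (Num.max x 0) + G (Num.min x 0).
  rewrite /G; have [x0|x0] := leP x 0.
  - by rewrite ?max_r ?min_l//; lra.
  - by rewrite ?max_l ?min_r ?(ltW x0)//; lra.
have Gpos : {homo (fun x => G (Num.max x 0)) : x y / x <= y}.
  move=> x y xy; set a := Num.max x 0; set b := Num.max y 0.
  have ab : a <= b by rewrite ge_max !le_max xy lexx !orbT.
  have a0 : 0 <= a by rewrite le_max lexx orbT.
  by have := sub a b; have := s_nd _ _ a0; rewrite /G; nra.
have Gneg : {homo (fun x => - G (Num.min x 0)) : x y / x <= y}.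
  move=> x y xy; set a := Num.min x 0; set b := Num.min y 0.
  have ab : a <= b by rewrite le_min !ge_min xy lexx !orbT.
  have b0 : b <= 0 by rewrite ge_min lexx orbT.
  by have := sub b a; have := s_nd _ _ b0; rewrite /G; nra.
rewrite (_ : g = fun x => G (Num.max x 0) - - G (Num.min x 0) + (g 0 + s 0 * x)).
  apply: measurable_funD; first apply: measurable_funB.
  - exact: nondecreasing_measurable.
  - exact: nondecreasing_measurable.
  - by apply: measurable_funD => //; exact: measurable_funM.
by apply/funext => x; rewrite opprK -GE /G; ring.
Qed.

(** * Convex order from comparisons with monotone weights *)

(** Up to truncation, integrate [G M + s M * (S - M) <= G S] and use the weighted comparison with
    weight [s]. The normalisation at 0 makes [G] non-negative, and [s] too on the half-line, so all
    integrals make sense in the extended reals. *)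
Lemma convex_order_shifted {d} {T : measurableType d} {R : realType}
    (mu : {measure set T -> \bar R}) (M S : T -> R) (G s : R -> R) :
  measurable_fun setT M -> measurable_fun setT S ->
  (forall t, 0 <= M t) -> (forall t, 0 <= S t) ->
  (\int[mu]_t (M t)%:E < +oo)%E ->
  (forall psi : R -> R, {homo psi : x y / x <= y} -> (forall x, 0 <= psi x) ->
    (\int[mu]_t (psi (M t) * M t)%:E <= \int[mu]_t (psi (M t) * S t)%:E)%E) ->
  (forall x y, G x + s x * (y - x) <= G y) -> {homo s : x y / x <= y} ->
  G 0 = 0 -> s 0 = 0 ->
  (\int[mu]_t (G (M t))%:E <= \int[mu]_t (G (S t))%:E)%E.
Proof.
move=> mM mS M0 S0 intM MS sub s_nd G0 s0.
have mG : measurable_fun setT G by exact: subgradient_measurable sub s_nd.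
have Gge0 x : 0 <= G x by have := sub 0 x; rewrite G0 s0; lra.
have G_nd x y : 0 <= x -> x <= y -> G x <= G y.
  by move=> x0 xy; have := sub x y; have := s_nd _ _ x0; rewrite s0; nra.
have mGM : measurable_fun setT (fun t => (G (M t))%:E).
  by apply/measurable_EFinP; exact: measurableT_comp.
have mGS : measurable_fun setT (fun t => (G (S t))%:E).
  by apply/measurable_EFinP; exact: measurableT_comp.
(* By monotone convergence it is enough to bound the integral of [G M] over [M <= N] for each
   [N]. *)
pose F (N : nat) := [set t | M t <= N%:R].
have mF N : measurable (F N).
  rewrite -[F N]setTI.
  exact: (measurable_fun_le measurableT mM (measurable_cst _)).
have Fcover : \bigcup_N F N = setT.
  apply/seteqP; split => // t _; exists (Num.Def.archi_bound (M t)) => //=.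
  by rewrite /F /= ltW// archi_boundP.
have Fnd : {homo F : n m / (n <= m)%N >-> (n <= m)%O}.
  move=> n m nm; apply/subsetPset => t /= /le_trans; apply.
  by rewrite ler_nat.
have cvgF : (\int[mu]_(t in F N) (G (M t))%:E)%E @[N --> \oo] -->
    (\int[mu]_t (G (M t))%:E)%E.
  rewrite -Fcover; apply: ge0_nondecreasing_set_cvg_integral => //.
  - by move=> i; apply: measurable_funTS.
  - by move=> i t _; rewrite lee_fin.
apply: (cvge_le _ cvgF); apply: nearW => N.
(* s is truncated at N so that E[psi(M) M] is finite and can be cancelled *)
pose psi x := s (Num.max 0 (Num.min x N%:R)).
(* Admissible weights must be non-negative on the whole line; the clamp at 0 ensures this because
   [s 0 = 0]. *)
have psi0 x : 0 <= psi x by rewrite -s0; apply: s_nd; rewrite le_max lexx.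
have psi_nd : {homo psi : x y / x <= y}.
  move=> x y xy; apply: s_nd; rewrite ge_max !le_max lexx /=; apply/orP; right.
  by rewrite le_min !ge_min xy lexx !orbT.
have psi_le x : psi x <= s N%:R.
  by apply: s_nd; rewrite ge_max ler0n ge_min lexx orbT.
have mpsi : measurable_fun setT (psi \o M).
  by apply: measurableT_comp => //; exact: nondecreasing_measurable.
pose a t := (psi (M t) * M t)%:E; pose b t := (psi (M t) * S t)%:E.
have ma : measurable_fun setT a by apply/measurable_EFinP/measurable_funM.
have mb : measurable_fun setT b by apply/measurable_EFinP/measurable_funM.
have a0 t : (0 <= a t)%E by rewrite lee_fin mulr_ge0.
have b0 t : (0 <= b t)%E by rewrite lee_fin mulr_ge0.
have afin : (\int[mu]_t a t \is a fin_num)%E.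
  rewrite ge0_fin_numE ?integral_ge0//.
  apply: (@le_lt_trans _ _ ((s N%:R)%:E * \int[mu]_t (M t)%:E)%E).
    rewrite -ge0_integralZl_EFin//; first apply: ge0_le_integral => //.
    - by apply: measurable_funeM; exact/measurable_EFinP.
    - by move=> t _; rewrite -EFinM lee_fin ler_wpM2r.
    - by move=> t _; rewrite lee_fin.
    - exact/measurable_EFinP.
    - exact: le_trans (psi0 0) (psi_le 0).
  by rewrite lte_mul_pinfty// lee_fin; exact: le_trans (psi0 0) (psi_le 0).
have mGF : measurable_fun setT ((fun t => (G (M t))%:E) \_ (F N)).
  by apply/(measurable_restrictT _ _).1 => //; exact: measurable_funTS.
have GF0 t : (0 <= ((fun t => (G (M t))%:E) \_ (F N)) t)%E.
  by apply: erestrict_ge0 => ? _; rewrite lee_fin.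
(* The finite integral of [a] is added to both sides. On the left [b] then replaces [a] by the
   weighted comparison, and the remaining inequality holds pointwise. *)
rewrite -(leeD2rE _ _ afin) integral_mkcond -!ge0_integralD//; last first.
  by move=> t _; rewrite lee_fin.
apply: (@le_trans _ _ (\int[mu]_t (((fun t => (G (M t))%:E) \_ (F N)) t + b t))%E).
  rewrite !ge0_integralD//; apply: leeD2l; exact: MS.
apply: ge0_le_integral => //.
- by move=> t _; rewrite adde_ge0.
- exact: emeasurable_funD.
- exact: emeasurable_funD.
move=> t _; rewrite patchE /a /b; case: ifPn => [|_].
  rewrite inE /F/= => MN; rewrite -!EFinD lee_fin.
  by have := sub (M t) (S t); rewrite /psi (min_l MN) (max_r (M0 t)); lra.
rewrite add0e -EFinD lee_fin.
have [MN|/ltW NM] := leP (M t) N%:R.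
  have := sub (M t) (S t); have := Gge0 (M t).
  by rewrite /psi (min_l MN) (max_r (M0 t)); lra.
(* Above the truncation level the subgradient is taken at [N] instead of [M]: [s N * S <= G S + s N
   * N - G N <= G S + s N * M]. *)
have := sub N%:R (S t); have := Gge0 N%:R; have := psi0 (M t).
by rewrite /psi (min_r NM) (max_r (ler0n R N)); nra.
Qed.

(** The negative part of [f + l] is dominated by [|l|]. Were its positive part of finite integral,
    [f + l] would be integrable, and so would [f = (f + l) - l]. *)
Lemma ge0_integralD_eqy {d} {T : measurableType d} {R : realType}
    (mu : {measure set T -> \bar R}) (f l : T -> R) :
  measurable_fun setT f -> (forall t, 0 <= f t) ->
  mu.-integrable setT (EFin \o l) ->
  (\int[mu]_t (f t)%:E = +oo -> \int[mu]_t (f t + l t)%:E = +oo)%E.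
Proof.
move=> mf f0 il foo.
pose h t := f t + l t.
have ml : measurable_fun setT l by apply/measurable_EFinP; case/integrableP: il.
have mh : measurable_fun setT (EFin \o h).
  by apply/measurable_EFinP/measurable_funD.
have hN : (\int[mu]_t ((EFin \o h)^\- t) < +oo)%E.
  case/integrableP: il => _; apply: le_lt_trans; apply: ge0_le_integral => //.
  - exact: measurable_funeneg.
  - exact/measurableT_comp/measurable_EFinP.
  - move=> t _; rewrite funenegE /= -EFin_max lee_fin /h.
    by have := f0 t; have := ler_norm (- l t); rewrite normrN ge_max normr_ge0; lra.
have hP : (\int[mu]_t ((EFin \o h)^\+ t) = +oo)%E.
  apply: contrapT => /eqP; rewrite -ltey => hP.
  have ih : mu.-integrable setT (EFin \o h).
    apply/integrableP; split => //.
    rewrite -[X in integral _ _ X]/(abse \o (EFin \o h)) fune_abse.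
    rewrite ge0_integralD//; first exact: lte_add_pinfty.
    - exact: measurable_funepos.
    - exact: measurable_funeneg.
  have /integrableP[_] : mu.-integrable setT (EFin \o f).
    apply: eq_integrable (integrableB measurableT ih il) => // t _ /=.
    by rewrite -EFinB addrK.
  by under eq_integral do rewrite /= ger0_norm//; rewrite foo ltxx.
rewrite integralE (_ : (\int[mu]_t (EFin \o _)^\+ t = +oo)%E).
by have : (\int[mu]_t ((EFin \o h)^\- t) \is a fin_num)%E;
  [rewrite ge0_fin_numE ?integral_ge0|move/fineK <-].
by [].
Qed.

(** Subtracting the supporting line [L] at 0 reduces to the non-negative case. Equal finite means
    give [L M] and [L S] the same finite expectation, so [L] can be added back. *)
Lemma convex_order {d} {T : measurableType d} {R : realType}
    (mu : probability T R) (M S : T -> R) (g : R -> R) :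
  measurable_fun setT M -> measurable_fun setT S ->
  (forall t, 0 <= M t) -> (forall t, 0 <= S t) ->
  (\int[mu]_t (M t)%:E < +oo)%E ->
  (\int[mu]_t (M t)%:E = \int[mu]_t (S t)%:E)%E ->
  (forall psi : R -> R, {homo psi : x y / x <= y} -> (forall x, 0 <= psi x) ->
    (\int[mu]_t (psi (M t) * M t)%:E <= \int[mu]_t (psi (M t) * S t)%:E)%E) ->
  @convex_function R R^o [set: R^o] g ->
  (\int[mu]_t (g (M t))%:E <= \int[mu]_t (g (S t))%:E)%E.
Proof.
move=> mM mS M0 S0 intM eqMS MS /convex_function_subgradient[s s_nd sub].
pose G x := g x - (g 0 + s 0 * x).
have Gsub x y : G x + (s x - s 0) * (y - x) <= G y.
  by rewrite /G; have := sub x y; lra.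
have s'_nd : {homo (fun x => s x - s 0) : x y / x <= y}.
  by move=> x y xy; rewrite lerD2r; exact: s_nd.
have G0 : G 0 = 0 by rewrite /G; ring.
have Gge0 x : 0 <= G x by have := sub 0 x; rewrite /G; lra.
have mG := subgradient_measurable _ _ _ Gsub s'_nd.
have GMS : (\int[mu]_t (G (M t))%:E <= \int[mu]_t (G (S t))%:E)%E.
  by apply: (convex_order_shifted _ _ _ _ _ mM mS M0 S0 intM MS Gsub s'_nd G0); rewrite subrr.
pose L x := g 0 + s 0 * x.
have gE x : g x = G x + L x by rewrite /G subrK.
have ge0_integrable (X : T -> R) : measurable_fun setT X -> (forall t, 0 <= X t) ->
    (\int[mu]_t (X t)%:E < +oo)%E -> mu.-integrable setT (EFin \o X).
  move=> mX X0 iX; apply/integrableP; split; first exact/measurable_EFinP.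
  by under eq_integral do rewrite /= ger0_norm//.
have iM := ge0_integrable _ mM M0 intM.
have iS : mu.-integrable setT (EFin \o S) by apply: ge0_integrable => //; rewrite -eqMS.
have i0 : mu.-integrable setT (EFin \o cst (g 0)).
  exact: finite_measure_integrable_cst.
have iZ X : mu.-integrable setT (EFin \o X) ->
    mu.-integrable setT (EFin \o (fun t => s 0 * X t)).
  by move=> iX; exact: (integrableZl measurableT (s 0) iX).
have iL X : mu.-integrable setT (EFin \o X) -> mu.-integrable setT (EFin \o (L \o X)).
  move=> iX; exact: (integrableD measurableT i0 (iZ _ iX)).
have intL (X : T -> R) : mu.-integrable setT (EFin \o X) ->
    (\int[mu]_t (L (X t))%:E =
     \int[mu]_t (g 0)%:E + (s 0)%:E * \int[mu]_t (X t)%:E)%E.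
  move=> iX; rewrite /L; under eq_integral do rewrite EFinD.
  by rewrite integralD//; [rewrite -integralZl//|exact: iZ].
(* If [G S] has infinite expectation, so has [g S] and the bound is trivial. Otherwise [G M] and
   [G S] are both integrable and the integrals split. *)
have [Soo|] := eqVneq (\int[mu]_t (G (S t))%:E)%E +oo%E.
  rewrite [leRHS](_ : _ = +oo%E) ?leey//; under eq_integral do rewrite gE.
  apply: (ge0_integralD_eqy mu (G \o S) (L \o S)) => //; last exact: iL.
    exact: measurableT_comp.
  by move=> t; exact: Gge0.
rewrite -ltey => Sfin.
have iGS : mu.-integrable setT (EFin \o (G \o S)).
  apply: ge0_integrable => //; first exact: measurableT_comp.
  by move=> t; exact: Gge0.
have iGM : mu.-integrable setT (EFin \o (G \o M)).
  apply: ge0_integrable; first exact: measurableT_comp.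
    by move=> t; exact: Gge0.
  exact: le_lt_trans Sfin.
under eq_integral do rewrite gE EFinD.
under [leRHS]eq_integral do rewrite gE EFinD.
rewrite integralD//; last exact: iL.
rewrite integralD//; last exact: iL.
by rewrite !intL// eqMS leeD2r.
Qed.

(** * Bounds on interim allocations and payments, and the support of a type *)

Lemma interim_alloc_ge0_le1 (R : realType) (n k : nat)
    (mu : probability (n.-tuple R) R) (A : n.-tuple R -> 'I_n -> bool) i x :
  alloc_rule k A -> 0 <= interim_alloc mu A i x <= 1.
Proof.
move=> [mA _]; rewrite /interim_alloc /Rintegral.
set I := (\int[mu]_v _)%E.
have I0 : (0 <= I)%E by apply: integral_ge0 => v _; rewrite lee_fin.
have I1 : (I <= 1)%E.
  have <- : (\int[mu]_v (cst 1 v) = 1)%E.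
    by rewrite integral_cst// mul1e; exact: probability_setT.
  apply: ge0_le_integral => //.
  - apply/measurable_EFinP.
    rewrite (_ : (fun _ => _) = \1_[set v | A v i] \o (fun v => upd v i x)).
      by apply: measurableT_comp => //; exact: measurable_upd.
    by apply/funext => v /=; rewrite indicE; congr (_ (nat_of_bool _));
      apply/idP/idP => [?|]; rewrite inE.
  - by move=> v _; rewrite lee_fin lern1 leq_b1.
have Ifin : I \is a fin_num by rewrite ge0_fin_numE// (le_lt_trans I1)// ltry.
by rewrite -!lee_fin fineK// I0.
Qed.

(** The allocation probability is at most 1 and the subtracted integral is non-negative. The bound
    serves to make the expected total payment finite. *)
Lemma interim_pay_le (R : realType) (n k : nat)
    (mu : probability (n.-tuple R) R) (A : n.-tuple R -> 'I_n -> bool) i x :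
  alloc_rule k A -> 0 <= x -> interim_pay mu A i x <= x.
Proof.
move=> aA x0; have /andP[a0 a1] := interim_alloc_ge0_le1 _ _ _ mu _ i x aA.
have J0 : 0 <= Rintegral lebesgue_measure (itv0 x) (interim_alloc mu A i).
  apply: fine_ge0; apply: integral_ge0 => y _; rewrite lee_fin.
  by have /andP[] := interim_alloc_ge0_le1 _ _ _ mu _ i y aA.
by rewrite /interim_pay lerBlDr (le_trans (ler_piMr x0 a1))// lerDl.
Qed.

(** The density formula integrates over the intersection with [[0, vbar i]], which is empty for the
    complement of that interval. *)
Lemma marginal_density_support (R : realType) (n : nat)
    (mu : probability (n.-tuple R) R) vbar f i :
  marginal_density mu vbar f -> mu [set v | ~ itv0 (vbar i) (tnth v i)] = 0.
Proof.
move=> /(_ i)[_ _ _ /(_ (~` itv0 (vbar i)))] ->; last first.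
  by apply: measurableC; exact: measurable_itv.
by rewrite setICl integral_set0.
Qed.

(** * Comparison of the total payments under [Pstar] and [P] *)

Theorem mainTheorem9 (R : realType) (n k : nat)
  (mu : probability (n.-tuple R) R) (vbar : 'I_n -> R) (f : 'I_n -> R -> R)
  (A : n.-tuple R -> 'I_n -> bool)
  (pi : 'I_n -> R -> R) (w : n.-tuple R -> 'I_n) :
  (1 <= k < n)%N ->
  indep_coords mu ->
  marginal_density mu vbar f ->
  alloc_rule k A ->
  implementable mu vbar A ->
  (forall i, measurable_fun setT (pi i) /\ forall x, 0 <= pi i x) ->
  (forall i, measurable [set v | w v = i]) ->
  (forall v j, pi j (tnth v j) <= pi (w v) (tnth v (w v))) ->
  revenue_equivalence mu vbar A (Pstar pi w) ->
  forall (g : R -> R), @convex_function R R^o [set: R^o] g ->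
  forall P : n.-tuple R -> 'I_n -> R, implements mu vbar A P ->
  expectation_exists mu (fun v => g (\sum_(i < n) Pstar pi w v i)) ->
  expectation_exists mu (fun v => g (\sum_(i < n) P v i)) ->
  (\int[mu]_v (g (\sum_(i < n) Pstar pi w v i))%:E <=
   \int[mu]_v (g (\sum_(i < n) P v i))%:E)%E.
Proof.
move=> _ indep dens aA _ mpi mw wmax REstar g cg P [payP _ REP] _ _.
pose p := Pstar pi w.
pose M v := \sum_(i < n) p v i; pose S v := \sum_(i < n) P v i.
have ME v : M v = pi (w v) (tnth v (w v)).
  rewrite /M (bigD1 (w v))//= /p /Pstar eqxx big1 ?addr0// => i /negbTE.
  by rewrite eq_sym => ->.
have p0 v i : 0 <= p v i.
  by rewrite /p /Pstar; case: ifP => // _; case: (mpi i).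
have mpii i : measurable_fun setT (fun v : n.-tuple R => pi i (tnth v i)).
  by apply: measurableT_comp; [case: (mpi i)|exact: measurable_tnth].
have mp i : measurable_fun setT (p ^~ i).
  rewrite (_ : p ^~ i = (fun v => \1_[set v | w v = i] v * pi i (tnth v i))).
    exact: measurable_funM.
  apply/funext => v; rewrite indicE /p /Pstar eq_sym.
  by case: eqP => wi; [rewrite mem_set// mul1r|rewrite memNset// mul0r].
have payp : payment_rule p by move=> i; split.
have mM : measurable_fun setT M by exact: measurable_sum.
have mS : measurable_fun setT S by apply: measurable_sum => i; case: (payP i).
have M0 v : 0 <= M v by exact: sumr_ge0.
have S0 v : 0 <= S v by apply: sumr_ge0 => i _; case: (payP i).
have supp i := marginal_density_support _ _ mu vbar f i dens.
have mitv i : measurable (itv0 (vbar i)) by exact: measurable_itv.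
(* Both rules have interim payment [interim_pay mu A i], so the weighted interim comparison applies
   in both directions. *)
have interimE i (psi : R -> R) : measurable_fun setT psi -> (forall x, 0 <= psi x) ->
    (\int[mu]_v (psi (tnth v i) * p v i)%:E =
     \int[mu]_v (psi (tnth v i) * P v i)%:E)%E.
  move=> mpsi psi0; have [mPi Pi0] := payP i.
  apply/eqP; rewrite eq_le; apply/andP; split;
    apply: (indep_coords_interim_le _ _ _ _ _ _ indep (mitv i) (supp i)) => // x xi.
  - by rewrite REstar ?REP.
  - by rewrite REstar ?REP.
have sumE (psi : n.-tuple R -> R) (Q : n.-tuple R -> 'I_n -> R) :
    payment_rule Q -> measurable_fun setT psi -> (forall v, 0 <= psi v) ->
    (\int[mu]_v (psi v * \sum_(i < n) Q v i)%:E =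
     \sum_(i < n) \int[mu]_v (psi v * Q v i)%:E)%E.
  move=> payQ mpsi psi0; rewrite -ge0_integral_sum//.
  - by apply: eq_integral => v _; rewrite mulr_sumr sumEFin.
  - by move=> i; apply/measurable_EFinP/measurable_funM => //; case: (payQ i).
  - by move=> i v _; rewrite lee_fin mulr_ge0//; case: (payQ i).
have intC c : (\int[mu]_v c%:E = c%:E)%E.
  by rewrite integral_cst// [X in (_ * X)%E]probability_setT mule1.
apply: (convex_order mu M S g) => //.
(* Finite mean of [M]: with weight 1, each payment is compared to the constant payment [vbar i],
   since [interim_pay mu A i x <= x <= vbar i]. *)
- under eq_integral do rewrite -[M _]mul1r.
  rewrite (sumE (cst 1))//; apply: lte_sum_pinfty => i _.
  apply: (@le_lt_trans _ _ (\int[mu]_v (1 * vbar i)%:E)%E).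
    have [vbar0 _ _ _] := dens i.
    apply: (indep_coords_interim_le _ _ _ (cst 1) _ (cst (vbar i)) indep (mitv i) (supp i)) => //.
      by move=> v; exact: ltW.
    move=> x xi; rewrite REstar// /= intC lee_fin.
    move: xi; rewrite /itv0 /= in_itv /= => /andP[x0 xv].
    by apply: le_trans xv; exact: interim_pay_le _ _ _ _ _ _ _ aA x0.
  by rewrite intC ltry.
(* Equal means: the interim identity with weight 1, summed over bidders. *)
- under eq_integral do rewrite -[M _]mul1r.
  under [RHS]eq_integral do rewrite -[S _]mul1r.
  rewrite (sumE (cst 1))// (sumE (cst 1))//; apply: eq_bigr => i _.
  exact: (interimE i (cst 1)).
move=> psi psi_nd psi0.
have mpsi : measurable_fun setT psi by exact: nondecreasing_measurable.
have mpsiM : measurable_fun setT (psi \o M) by exact: measurableT_comp.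
have psiM0 v : 0 <= psi (M v) by exact: psi0.
have sumM Q payQ := sumE (fun v => psi (M v)) Q payQ mpsiM psiM0.
rewrite (sumM p)// (sumM P)//; apply: lee_sum => i _.
have [mPi Pi0] := payP i.
have mpsipi : measurable_fun setT (fun v : n.-tuple R => psi (pi i (tnth v i))).
  exact: measurableT_comp.
(* p_i vanishes unless bidder i attains the maximum, where M v = pi_i(v_i) *)
rewrite (_ : (\int[mu]_v _)%E = \int[mu]_v (psi (pi i (tnth v i)) * p v i)%:E)%E; last first.
  apply: eq_integral => v _; rewrite /= ME /p /Pstar.
  by case: eqP => [->|]//; rewrite !mulr0.
(* The weight now depends on [v_i] alone, unlike [psi (M v)], so [p] can be exchanged for [P]. *)
rewrite (interimE i (psi \o pi i)); last 2 first.
- by apply: measurableT_comp => //; case: (mpi i).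
- by move=> x; exact: psi0.
apply: ge0_le_integral => //.
- by move=> v _; rewrite lee_fin; apply: mulr_ge0; [exact: psi0|exact: Pi0].
- by apply/measurable_EFinP; exact: (measurable_funM mpsipi mPi).
- by apply/measurable_EFinP; exact: (measurable_funM mpsiM mPi).
by move=> v _; rewrite lee_fin ler_wpM2r//; apply: psi_nd; rewrite ME.
Qed.
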